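(* For $\Re s>1$ and $q=-1$, the following identities hold in the Abel sense: $$\sum_{n\ge2}\frac{\mathfrak S(n,-1)}{n^s}=2\,\zeta(s)\,\bigl(1-\eta(s)\bigr),\qquad \sum_{n\ge2}\frac{\mathfrak F(n,-1)}{n^s}=2\,\bigl(\zeta(s)-1\bigr)\bigl(1-\eta(s)\bigr),$$ where $\eta(s)=\sum_{n\ge1}(-1)^{n-1}n^{-s}=(1-2^{1-s})\zeta(s)$ is the Dirichlet eta function.
   Context: For $z\in\mathbb C$ and an integer $i\ge2$, $F(z,i)=i+2\sum_{k=1}^{i-1}(i-k)\cos(2\pi kz/i)$. For $0<r<1$ set $$\mathfrak S_r(z)=2\sum_{i\ge2}(-r)^i\,\frac{F(z,i)}{i^2},\qquad \mathfrak F_r(z)=\mathfrak S_r(z)-2e^{-\mathrm i\pi z},$$ and define $\mathfrak S(z,-1)=\lim_{r\uparrow1}\mathfrak S_r(z)$, $\mathfrak F(z,-1)=\lim_{r\uparrow1}\mathfrak F_r(z)$ (the limits exist locally uniformly in $z$). ''In the Abel sense'' means that the damping parameter $0<r<1$ is inserted (replacing $\mathfrak S(n,-1),\mathfrak F(n,-1)$ by $\mathfrak S_r(n),\mathfrak F_r(n)$) and then the limit $r\uparrow1$ is taken. At integers $n$ the sums defining $\mathfrak S_r(n)$ have only finitely many nonzero terms. $\zeta$ is the Riemann zeta function. *)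

(* Defs.v *)
From Stdlib Require Import Reals.
From Coquelicot Require Import Coquelicot.
Open Scope R_scope.
Open Scope C_scope.

Definition Cexp (z : C) : C :=
  (exp (Re z) * cos (Im z), exp (Re z) * sin (Im z))%R.

Definition Ccos (z : C) : C := (Cexp (Ci * z) + Cexp (- (Ci * z))) / 2.

Definition natC (n : nat) : C := RtoC (INR n).

(** n^s with the real logarithm of n; meaningful for n >= 1. *)
Definition nat_Cpower (n : nat) (s : C) : C := Cexp (s * RtoC (ln (INR n))).

(** Coquelicot's [Series] is real valued.  Like [Series], [CSeries a] is total
    and only meaningful when the series converges. *)
Definition CSeries (a : nat -> C) : C :=
  (Series (fun n => Re (a n)), Series (fun n => Im (a n))).

Lemma is_series_CSeries (a : nat -> C) (l : C) :
  is_series a l -> CSeries a = l.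
Proof.
  intros H.
  assert (Hsum : forall n : nat,
    sum_n a n = (sum_n (fun k => Re (a k)) n, sum_n (fun k => Im (a k)) n)).
  { induction n as [|n IH].
    - rewrite !sum_O. apply surjective_pairing.
    - rewrite !sum_Sn, IH. reflexivity. }
  unfold CSeries. rewrite (surjective_pairing l). f_equal.
  - apply is_series_unique. intros P [e HP].
    destruct (H (fun z => P (Re z))) as [N HN].
    + exists e. intros z Hz. apply HP. exact (proj1 Hz).
    + exists N. intros n Hn. specialize (HN n Hn). now rewrite Hsum in HN.
  - apply is_series_unique. intros P [e HP].
    destruct (H (fun z => P (Im z))) as [N HN].
    + exists e. intros z Hz. apply HP. exact (proj2 Hz).
    + exists N. intros n Hn. specialize (HN n Hn). now rewrite Hsum in HN.
Qed.

Definition F (z : C) (i : nat) : C :=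
  natC i + 2 * sum_n_m (fun k => natC (i - k) *
                   Ccos (2 * RtoC PI * natC k * z / natC i)) 1 (i - 1).

(** The sum over i >= 2, indexed by i = j + 2. *)
Definition S_damped (r : R) (z : C) : C :=
  2 * CSeries (fun j => let i := (j + 2)%nat in
                 RtoC (- r) ^ i * (F z i / natC i ^ 2)).

Definition F_damped (r : R) (z : C) : C :=
  S_damped r z - 2 * Cexp (- (Ci * RtoC PI * z)).

(** On the half-plane Re s > 1 only, where these series converge. *)
Definition zeta (s : C) : C :=
  CSeries (fun m => 1 / nat_Cpower (m + 1) s).

Definition eta (s : C) : C :=
  CSeries (fun m => RtoC (- 1) ^ m / nat_Cpower (m + 1) s).

(** [abel_dirichlet f s l]: for every 0 < r < 1 the series of f r n / n^s over
    n >= 2 (indexed by n = m + 2) converges, and its sum tends to [l] as r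
    increases to 1. *)
Definition abel_dirichlet (f : R -> C -> C) (s l : C) : Prop :=
  exists A : R -> C,
    (forall r : R, (0 < r < 1)%R ->
       is_series (fun m => let n := (m + 2)%nat in
                    f r (natC n) / nat_Cpower n s) (A r)) /\
    filterlim A (at_left 1%R) (locally l).

(* Main.v *)
Require Import Defs.
From Stdlib Require Import Reals Lra Lia.
From Coquelicot Require Import Coquelicot.

(** At an integer n, [F n i] is a Fejer sum at the angle 2 PI n / i: it equals
    i ^ 2 if i divides n and 0 otherwise ([F_natC]). Hence [S_damped r] at n
    is 2 sum (- r) ^ i over the divisors i >= 2 of n, a Dirichlet convolution
    of (- r) ^ i with the constant 1. Its Dirichlet series therefore factors as
    2 zeta(s) sum_{i >= 2} (- r) ^ i i ^ (- s)
    ([is_series_S_damped_dirichlet]). The factorisation is an exchange of two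
    summations ([is_series_exchange]), after which the inner sum over the
    multiples of i is i ^ (- s) zeta(s), n ^ (- s) being completely
    multiplicative ([is_series_multiples_dirichlet]).

    As r increases to 1, the remaining factor tends to
    sum_{i >= 2} (- 1) ^ i i ^ (- s) = 1 - eta(s), by dominated convergence with
    dominating series sum i ^ (- Re s) ([tannery],
    [filterlim_alternating_series]). This is the identity for [S_damped]. At an
    integer the exponential subtracted in [F_damped] is (- 1) ^ n, which
    contributes - 2 (1 - eta(s)), whence the identity for [F_damped].

    The relation between eta and zeta comes from the same sum over multiples,
    with i = 2: the terms of eta are those of zeta minus twice those with n
    even. *)

Open Scope R_scope.

(** * Dominated convergence for series *)

Section Summation.
Context {K : AbsRing} {V : NormedModule K}.

Lemma norm_series_tail (a : nat -> V) (u : nat -> R) (l : V) (U : R) (n : nat) :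
  (forall k, norm (a k) <= u k) -> is_series a l -> is_series u U ->
  norm (minus l (sum_n a n)) <= U - sum_n u n.
Proof.
  intros Hau Ha Hu.
  assert (Hl : filterlim (fun m => norm (minus (sum_n a m) (sum_n a n)))
                 eventually (locally (norm (minus l (sum_n a n))))).
  { eapply filterlim_comp; [| apply filterlim_norm].
    apply (filterlim_comp_2 (sum_n a) (fun _ => opp (sum_n a n)) plus Ha
             (filterlim_const _)), filterlim_plus. }
  assert (HU : filterlim (fun m => sum_n u m - sum_n u n)
                 eventually (locally (U - sum_n u n))).
  { exact (is_lim_seq_minus' _ _ _ _ Hu (is_lim_seq_const _)). }
  refine (filterlim_le (F := eventually) _ _
            (Finite (norm (minus l (sum_n a n)))) (Finite (U - sum_n u n))
            _ Hl HU).
  exists n; intros m Hm.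
  replace (minus (sum_n a m) (sum_n a n)) with (sum_n_m a (S n) m)
    by exact (sum_n_m_sum_n (G := NormedModule.AbelianGroup K V) a n m Hm).
  eapply Rle_trans; [apply norm_sum_n_m |].
  eapply Rle_trans; [apply sum_n_m_le; exact Hau |].
  right; now apply (sum_n_m_sum_n u).
Qed.

(** Dominated convergence for series, along an arbitrary filter. It serves twice:
    along partial sums, to exchange two summations, and along r tending to 1, to
    take the Abel limit term by term. *)
Lemma tannery {T : Type} (D : (T -> Prop) -> Prop) {PD : ProperFilter D}
    (f : T -> nat -> V) (A : T -> V) (g : nat -> V) (l : V) (u : nat -> R) :
  ex_series u ->
  D (fun t => is_series (f t) (A t) /\ forall i, norm (f t i) <= u i) ->
  (forall i, filterlim (fun t => f t i) D (locally (g i))) ->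
  is_series g l ->
  filterlim A D (locally l).
Proof.
  intros [U HU] Hf Hfg Hg.
  assert (Hgu : forall i, norm (g i) <= u i).
  { intros i.
    refine (filterlim_le (F := D) (fun t => norm (f t i)) (fun _ => u i)
              (Finite (norm (g i))) (Finite (u i)) _ _ (filterlim_const _)).
    - revert Hf; apply filter_imp; intros t Ht; apply Ht.
    - eapply filterlim_comp; [apply Hfg | apply filterlim_norm]. }
  assert (Hsum : forall n,
            filterlim (fun t => sum_n (f t) n) D (locally (sum_n g n))).
  { induction n as [|n IH].
    - rewrite sum_O. eapply filterlim_ext; [| apply (Hfg 0%nat)].
      intros t; now rewrite sum_O.
    - rewrite sum_Sn.
      eapply filterlim_ext; [intros t; symmetry; apply sum_Sn |].
      eapply filterlim_comp_2; [apply IH | apply Hfg | apply filterlim_plus]. }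
  (* Cut the series at n with tail of u below eps / 3: the two tails and the
     difference of the partial sums then each cost at most eps / 3. *)
  apply (proj2 (filterlim_locally_ball_norm A l)). intros eps.
  assert (He : 0 < eps / 3) by (pose proof (cond_pos eps); lra).
  destruct (proj1 (filterlim_locally_ball_norm _ _) HU (mkposreal _ He))
    as [n Hn].
  specialize (Hn n (Nat.le_refl n)).
  assert (Htail : U - sum_n u n < eps / 3).
  { change (Rabs (sum_n u n - U) < eps / 3) in Hn.
    apply Rabs_def2 in Hn. lra. }
  generalize (filter_and _ _ Hf
    (proj1 (filterlim_locally_ball_norm _ _) (Hsum n) (mkposreal _ He))).
  apply filter_imp. intros t [[Ht Htu] Hball].
  unfold ball_norm in *; simpl in Hball.
  pose proof (norm_series_tail _ _ _ _ n Htu Ht HU) as H1.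
  pose proof (norm_series_tail _ _ _ _ n Hgu Hg HU) as H2.
  rewrite (minus_trans (G := NormedModule.AbelianGroup K V) (sum_n (f t) n)),
    (minus_trans (G := NormedModule.AbelianGroup K V) (sum_n g n) _ l).
  rewrite <- norm_opp, opp_minus in H2.
  eapply Rle_lt_trans; [apply norm_triangle |].
  eapply Rle_lt_trans; [apply Rplus_le_compat_l, norm_triangle |].
  lra.
Qed.

(** Fubini for double series, under a dominating product u i * v n. The rows are
    only asked to converge one at a time: the sum of the row sums is obtained
    as a limit of series over i, whose terms are bounded by u i times the sum
    of v. *)
Lemma is_series_exchange (c : nat -> nat -> V) (u v : nat -> R)
    (row col : nat -> V) (l : V) :
  ex_series u -> ex_series v ->
  (forall i n, norm (c i n) <= u i * v n) ->
  (forall n, is_series (fun i => c i n) (row n)) ->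
  (forall i, is_series (c i) (col i)) ->
  is_series col l ->
  is_series row l.
Proof.
  intros Hu [W HW] Hc Hrow Hcol Hl.
  assert (Hpos : forall i n, 0 <= u i * v n)
    by (intros; exact (Rle_trans _ _ _ (norm_ge_0 (c i n)) (Hc i n))).
  (* Tannery along N, for the series over i of the partial sums over n <= N. *)
  apply (tannery eventually (fun N i => sum_n (c i) N) _ col l
           (fun i => u i * W)).
  - now apply ex_series_scal_r.
  - exists 0%nat. intros N _. split.
    + induction N as [|N IH].
      * rewrite sum_O. eapply is_series_ext; [| apply Hrow].
        intros i; now rewrite sum_O.
      * rewrite sum_Sn.
        eapply is_series_ext; [| apply is_series_plus; [apply IH | apply Hrow]].
        intros i; now rewrite sum_Sn.
    + intros i.
      eapply Rle_trans; [apply norm_sum_n_m |].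
      eapply Rle_trans; [apply sum_n_m_le; intros n; apply Hc |].
      pose proof (is_series_scal_l (u i) v W HW) as HS.
      refine (is_lim_seq_incr_compare _ _ HS _ N).
      intros n. rewrite sum_Sn. unfold plus; simpl.
      specialize (Hpos i (S n)). unfold scal; simpl; unfold mult; simpl. lra.
  - exact Hcol.
  - exact Hl.
Qed.

End Summation.

Lemma is_series_zero {K : AbsRing} {V : NormedModule K} :
  is_series (fun _ : nat => zero : V) zero.
Proof.
  eapply filterlim_ext; [| apply filterlim_const].
  intros n. symmetry. apply sum_n_m_const_zero.
Qed.

(** * The Riemann series *)

(** Convergence of the sum of n ^ (- x), by telescoping: since
    ln (n + 1) - ln n >= 1 / (n + 1), the difference n ^ (1 - x) - (n + 1) ^ (1 - x)
    is at least (x - 1) (n + 1) ^ (- x). *)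
Lemma ex_series_Riemann (x : R) :
  1 < x -> ex_series (fun n => exp (- x * ln (INR (S n)))).
Proof.
  intros Hx.
  set (p := fun y n => exp (- y * ln (INR (S n)))).
  assert (Hstep : forall n,
            (x - 1) * p x (S n) <= p (x - 1) n - p (x - 1) (S n)).
  { intros n. unfold p.
    set (a := INR (S n)).
    assert (Ha : 0 < a) by (apply lt_0_INR; lia).
    replace (INR (S (S n))) with (a + 1) by (unfold a; now rewrite <- S_INR).
    (* From 1 + y <= exp y at y = ln (a / (a + 1)). *)
    assert (Hln : / (a + 1) <= ln (a + 1) - ln a).
    { pose proof (exp_ineq1_le (ln a - ln (a + 1))) as H.
      replace (exp (ln a - ln (a + 1))) with (a * / (a + 1)) in H
        by (unfold Rminus; rewrite exp_plus, exp_Ropp, !exp_ln by lra; ring).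
      replace (a * / (a + 1)) with (1 - / (a + 1)) in H by (field; lra). lra. }
    assert (E1 : exp (- (x - 1) * ln a) =
      exp (- (x - 1) * ln (a + 1)) * exp ((x - 1) * (ln (a + 1) - ln a))).
    { rewrite <- exp_plus. f_equal. ring. }
    assert (E2 : exp (- x * ln (a + 1)) =
      exp (- (x - 1) * ln (a + 1)) * / (a + 1)).
    { rewrite <- (exp_ln (a + 1)) at 3 by lra. rewrite <- exp_Ropp, <- exp_plus.
      f_equal. ring. }
    rewrite E1, E2.
    pose proof (exp_ineq1_le ((x - 1) * (ln (a + 1) - ln a))) as H.
    pose proof (exp_pos (- (x - 1) * ln (a + 1))) as Hp.
    assert (H' : (x - 1) * / (a + 1) <= (x - 1) * (ln (a + 1) - ln a))
      by (apply Rmult_le_compat_l; lra).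
    nra. }
  assert (Hb : forall n, sum_n (p x) n <=
            p x 0%nat + / (x - 1) * (p (x - 1) 0%nat - p (x - 1) n)).
  { assert (Hi : 0 < / (x - 1)) by (apply Rinv_0_lt_compat; lra).
    induction n as [|n IH].
    - rewrite sum_O. lra.
    - rewrite sum_Sn. change (@plus R_AbelianMonoid) with Rplus.
      assert (H : p x (S n) <= / (x - 1) * (p (x - 1) n - p (x - 1) (S n))).
      { apply (Rmult_le_reg_l (x - 1)); [lra |].
        rewrite <- Rmult_assoc, Rinv_r, Rmult_1_l by lra. apply Hstep. }
      lra. }
  apply (ex_finite_lim_seq_incr _ (p x 0%nat + / (x - 1) * p (x - 1) 0%nat)).
  - intros n. rewrite sum_Sn.
    change (sum_n (p x) n <= sum_n (p x) n + p x (S n)).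
    assert (0 < p x (S n)) by apply exp_pos. lra.
  - intros n. eapply Rle_trans; [apply Hb |].
    assert (0 < / (x - 1)) by (apply Rinv_0_lt_compat; lra).
    assert (0 < p (x - 1) n) by apply exp_pos.
    assert (0 <= / (x - 1) * p (x - 1) n) by (apply Rmult_le_pos; lra). lra.
Qed.

(** * The Fejer kernel *)

(** The Fejer kernel i + 2 sum (i - k) cos (k t) in closed form. Multiplying by
    1 - cos t instead of dividing keeps the identity valid at cos t = 1 and
    makes it telescope twice. *)
Lemma fejer_sum (t : R) (i : nat) :
  (1 - cos t) *
    (INR i + 2 * sum_n_m (fun k => INR (i - k) * cos (INR k * t)) 1 (i - 1)) =
  1 - cos (INR i * t).
Proof.
  (* The Dirichlet kernel is the increment of the Fejer sum from i to i + 1. *)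
  assert (Hdir : forall n,
            (1 - cos t) * (1 + 2 * sum_n_m (fun k => cos (INR k * t)) 1 n) =
            cos (INR n * t) - cos (INR (S n) * t)).
  { induction n as [|n IH].
    - rewrite sum_n_m_zero by lia. unfold zero; simpl.
      rewrite Rmult_0_l, cos_0, Rmult_1_l. ring.
    - rewrite sum_n_Sm by lia. change (@plus R_AbelianMonoid) with Rplus.
      match goal with |- _ * (1 + 2 * (?S + ?c)) = _ =>
        replace ((1 - cos t) * (1 + 2 * (S + c)))
          with ((1 - cos t) * (1 + 2 * S) + 2 * (1 - cos t) * c) by ring end.
      rewrite IH.
      replace (INR n * t) with (INR (S n) * t - t) by (rewrite S_INR; ring).
      replace (INR (S (S n)) * t) with (INR (S n) * t + t)
        by (rewrite (S_INR (S n)); ring).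
      rewrite cos_minus, cos_plus. ring. }
  induction i as [|i IH].
  - rewrite sum_n_m_zero by lia. unfold zero; simpl.
    rewrite Rmult_0_l, cos_0. ring.
  - assert (E : sum_n_m (fun k => INR (S i - k) * cos (INR k * t)) 1 (S i - 1) =
      sum_n_m (fun k => INR (i - k) * cos (INR k * t)) 1 (i - 1) +
      sum_n_m (fun k => cos (INR k * t)) 1 i).
    { replace (S i - 1)%nat with i by lia.
      destruct i as [|i].
      - rewrite !sum_n_m_zero by lia. unfold zero; simpl; ring.
      - replace (S i - 1)%nat with i by lia.
        rewrite (sum_n_m_ext_loc (fun k => INR (S (S i) - k) * cos (INR k * t))
          (fun k => plus (INR (S i - k) * cos (INR k * t)) (cos (INR k * t)))).
        2:{ intros k Hk. replace (S (S i) - k)%nat with (S (S i - k)) by lia.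
            rewrite S_INR. unfold plus; simpl; ring. }
        rewrite sum_n_m_plus. change (@plus R_AbelianMonoid) with Rplus. f_equal.
        rewrite sum_n_Sm by lia. rewrite Nat.sub_diag.
        change (@plus R_AbelianMonoid) with Rplus.
        rewrite Rmult_0_l. apply Rplus_0_r. }
    rewrite E, S_INR, Rmult_plus_distr_r, Rmult_1_l.
    replace (INR i * t + t) with (INR (S i) * t) by (rewrite S_INR; ring).
    specialize (Hdir i). lra.
Qed.

Open Scope C_scope.

(** * Complex exponentials *)

Lemma Cexp_0 : Cexp 0 = 1.
Proof.
  unfold Cexp, RtoC; simpl. now rewrite exp_0, cos_0, sin_0, !Rmult_1_l.
Qed.

Lemma Cexp_plus (a b : C) : Cexp (a + b) = Cexp a * Cexp b.
Proof.
  destruct a as [a1 a2], b as [b1 b2]. unfold Cexp, Cmult; simpl.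
  rewrite exp_plus, cos_plus, sin_plus. f_equal; ring.
Qed.

Lemma Cmod_Cexp (z : C) : Cmod (Cexp z) = exp (Re z).
Proof.
  destruct z as [x y]. unfold Cexp, Cmod; simpl.
  match goal with |- sqrt ?e = _ =>
    replace e with (exp x * exp x * (Rsqr (sin y) + Rsqr (cos y)))%R
      by (unfold Rsqr; ring) end.
  rewrite sin2_cos2, Rmult_1_r. apply sqrt_square, Rlt_le, exp_pos.
Qed.

Lemma Cexp_neq_0 (z : C) : Cexp z <> 0.
Proof. apply Cmod_gt_0. rewrite Cmod_Cexp. apply exp_pos. Qed.

Lemma Cexp_opp z : Cexp (- z) = / Cexp z.
Proof.
  assert (H : Cexp (- z) * Cexp z = 1).
  { rewrite <- Cexp_plus. replace (- z + z) with (RtoC 0) by ring.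
    apply Cexp_0. }
  rewrite <- (Cmult_1_l (/ Cexp z)), <- H. field. apply Cexp_neq_0.
Qed.

Lemma Ccos_RtoC (x : R) : Ccos (RtoC x) = RtoC (cos x).
Proof.
  unfold Ccos.
  assert (E : Cexp (Ci * x) + Cexp (- (Ci * x)) = 2 * RtoC (cos x)).
  { unfold Cexp, Ci, RtoC, Copp, Cmult, Cplus; simpl.
    replace (0 * x - 1 * 0)%R with 0%R by ring.
    replace (0 * 0 + 1 * x)%R with x by ring.
    rewrite Ropp_0, exp_0, cos_neg, sin_neg. f_equal; ring. }
  rewrite E. field.
Qed.

Lemma Cexp_opp_Ci_PI (n : nat) :
  Cexp (- (Ci * RtoC PI * natC n)) = RtoC (- 1) ^ n.
Proof.
  unfold natC. induction n as [|n IH].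
  - simpl. replace (- (Ci * PI * 0)) with (RtoC 0) by ring.
    apply Cexp_0.
  - rewrite S_INR, RtoC_plus.
    replace (- (Ci * PI * (INR n + 1)))
      with (- (Ci * PI * INR n) + - (Ci * PI)) by ring.
    rewrite Cexp_plus, IH. simpl.
    replace (Cexp (- (Ci * PI))) with (RtoC (-1)); [ring |].
    unfold Cexp, Ci, RtoC, Copp, Cmult; simpl.
    replace (- (0 * PI - 1 * 0))%R with 0%R by ring.
    replace (- (0 * 0 + 1 * PI))%R with (- PI)%R by ring.
    rewrite exp_0, cos_neg, sin_neg, cos_PI, sin_PI. f_equal; ring.
Qed.

(** * The sum F at integers *)

Definition divides_ind (i n : nat) : C := if (n mod i =? 0)%nat then 1 else 0.

Lemma Cmod_divides_ind i n : (Cmod (divides_ind i n) <= 1)%R.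
Proof.
  unfold divides_ind. destruct (_ =? _)%nat; rewrite ?Cmod_1, ?Cmod_0; lra.
Qed.

Lemma sum_n_m_RtoC (f : nat -> R) a b :
  sum_n_m (fun k => RtoC (f k)) a b = RtoC (sum_n_m f a b).
Proof.
  destruct (Nat.le_gt_cases a b) as [H|H].
  2:{ rewrite !sum_n_m_zero by lia. reflexivity. }
  induction H as [|b H IH].
  - rewrite !sum_n_n. reflexivity.
  - rewrite !sum_n_Sm, IH by lia. symmetry. apply RtoC_plus.
Qed.

(** At an integer n the angle t = 2 PI n / i satisfies cos (i t) = 1, so the Fejer
    sum vanishes by its closed form unless cos t = 1, that is unless i divides n.
    This is what turns [S_damped] into a divisor sum. *)
Lemma F_natC n i :
  (0 < i)%nat -> F (natC n) i = divides_ind i n * natC i ^ 2.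
Proof.
  intros Hi.
  assert (HiR : (0 < INR i)%R) by now apply lt_0_INR.
  set (t := (2 * PI * INR n / INR i)%R).
  assert (E : F (natC n) i = RtoC (INR i +
      2 * sum_n_m (fun k => INR (i - k) * cos (INR k * t))%R 1 (i - 1))%R).
  { unfold F. rewrite RtoC_plus, RtoC_mult, <- sum_n_m_RtoC.
    unfold natC at 1. do 2 f_equal. apply sum_n_m_ext. intros k.
    rewrite RtoC_mult, <- Ccos_RtoC. unfold natC. do 2 f_equal.
    unfold t. rewrite RtoC_mult, RtoC_div, !RtoC_mult by lra.
    field. intros H. apply RtoC_inj in H. lra. }
  rewrite E. clear E. unfold divides_ind, natC.
  destruct (Nat.eqb_spec (n mod i) 0) as [e|ne].
  - (* All the cosines are 1. *)
    rewrite Cmult_1_l, <- RtoC_pow. f_equal.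
    apply Nat.Div0.mod_divides in e. destruct e as [q ->].
    assert (Hsum : forall m, sum_n_m (fun k => INR (m - k)) 1 (m - 1) =
                             (INR m * (INR m - 1) / 2)%R).
    { induction m as [|m IH].
      - rewrite sum_n_m_zero by lia. unfold zero; simpl. lra.
      - replace (S m - 1)%nat with m by lia.
        destruct m as [|m].
        + rewrite sum_n_m_zero by lia. unfold zero; simpl. lra.
        + rewrite sum_Sn_m by lia.
          replace (S m - 1)%nat with m in IH by lia.
          rewrite <- (sum_n_m_S (fun k => INR (S (S m) - k)) 1 m).
          change (fun n => INR (S (S m) - S n)) with (fun k => INR (S m - k)).
          rewrite IH.
          replace (S (S m) - 1)%nat with (S m) by lia.
          change (@plus R_AbelianMonoid) with Rplus.
          rewrite (S_INR (S m)). lra. }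
    rewrite (sum_n_m_ext _ (fun k => INR (i - k))), Hsum; [simpl; lra |].
    intros k.
    replace (INR k * t)%R with (0 + 2 * INR (k * q) * PI)%R
      by (unfold t; rewrite !mult_INR; field; lra).
    rewrite cos_period, cos_0. apply Rmult_1_r.
  - rewrite Cmult_0_l. f_equal.
    (* cos t = 1 would make t / 2 = PI * n / i a multiple of PI. *)
    assert (Hcos : (1 - cos t <> 0)%R).
    { intros H0. apply ne.
      replace t with (2 * (t / 2))%R in H0 by field.
      rewrite cos_2a_sin in H0.
      assert (Hs : sin (t / 2) = 0%R) by nra.
      apply sin_eq_0_0 in Hs. destruct Hs as [k Hk].
      assert (Hn : INR n = (IZR k * INR i)%R).
      { apply (Rmult_eq_reg_l (PI / INR i)).
        - replace (PI / INR i * INR n)%R with (t / 2)%R by (unfold t; field; lra).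
          rewrite Hk. field. lra.
        - pose proof PI_RGT_0. apply Rgt_not_eq, Rdiv_lt_0_compat; lra. }
      rewrite !INR_IZR_INZ, <- mult_IZR in Hn. apply eq_IZR in Hn.
      apply Nat.Div0.mod_divides. exists (Z.to_nat k). nia. }
    apply (Rmult_eq_reg_l (1 - cos t)); [| exact Hcos].
    rewrite fejer_sum, Rmult_0_r.
    replace (INR i * t)%R with (0 + 2 * INR n * PI)%R by (unfold t; field; lra).
    rewrite cos_period, cos_0. ring.
Qed.

(** * Dirichlet series over multiples *)

Lemma nat_Cpower_mult (a b : nat) (s : C) : (0 < a)%nat -> (0 < b)%nat ->
  nat_Cpower (a * b) s = nat_Cpower a s * nat_Cpower b s.
Proof.
  intros Ha Hb. unfold nat_Cpower. rewrite <- Cexp_plus. f_equal.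
  rewrite mult_INR, ln_mult, RtoC_plus by now apply lt_0_INR. ring.
Qed.

(** The value 0 at n = 0 makes n |-> n ^ (- s) completely multiplicative on all
    of nat, so that series can be indexed from 0. *)
Definition dirichlet_term (s : C) (n : nat) : C :=
  match n with O => 0 | S _ => / nat_Cpower n s end.

Lemma nat_Cpower_1_minus n s :
  (0 < n)%nat -> nat_Cpower n (1 - s) = natC n * dirichlet_term s n.
Proof.
  intros Hn. destruct n as [|n]; [lia |].
  unfold dirichlet_term, nat_Cpower.
  replace ((1 - s) * RtoC (ln (INR (S n))))
    with (RtoC (ln (INR (S n))) + - (s * RtoC (ln (INR (S n))))) by ring.
  rewrite Cexp_plus, Cexp_opp. f_equal.
  unfold Cexp, natC, RtoC; cbn -[INR].
  rewrite cos_0, sin_0, exp_ln by (apply lt_0_INR; lia).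
  f_equal; ring.
Qed.

Lemma dirichlet_term_mult s a b :
  dirichlet_term s (a * b) = dirichlet_term s a * dirichlet_term s b.
Proof.
  destruct a as [|a]; [simpl; ring |].
  destruct b as [|b]; [rewrite Nat.mul_0_r; simpl; ring |].
  change (/ nat_Cpower (S a * S b) s =
          / nat_Cpower (S a) s * / nat_Cpower (S b) s).
  rewrite nat_Cpower_mult by lia. field. split; apply Cexp_neq_0.
Qed.

Lemma Cmod_dirichlet_term s n :
  Cmod (dirichlet_term s (S n)) = exp (- Re s * ln (INR (S n))).
Proof.
  unfold dirichlet_term, nat_Cpower.
  rewrite Cmod_inv, Cmod_Cexp, <- exp_Ropp by apply Cexp_neq_0.
  f_equal. destruct s; unfold Cmult, RtoC; cbn -[INR]. ring.
Qed.

Lemma ex_series_Cmod_dirichlet_term s : (1 < Re s)%R ->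
  ex_series (fun n => Cmod (dirichlet_term s n)).
Proof.
  intros Hs. apply ex_series_incr_1.
  eapply ex_series_ext; [intros n; symmetry; apply Cmod_dirichlet_term |].
  now apply ex_series_Riemann.
Qed.

Lemma is_series_drop_1 (a : nat -> C) (l : C) :
  is_series a l -> is_series (fun m => a (S m)) (l - a 0%nat).
Proof.
  intros Ha. apply is_series_incr_1.
  match goal with |- is_series _ ?x => replace x with l; [exact Ha |] end.
  unfold plus; simpl. ring.
Qed.

(** The term at 1 is kept explicit because it need not vanish: for the alternating
    series it is what produces the 1 in 1 - eta s. *)
Lemma is_series_drop_2 (a : nat -> C) (l : C) :
  a 0%nat = 0 -> is_series a l ->
  is_series (fun m => a (m + 2)%nat) (l - a 1%nat).
Proof.
  intros H0 Ha.
  apply (is_series_ext (fun m => a (S (S m)))).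
  { intros m. now rewrite Nat.add_comm. }
  apply is_series_drop_1, (is_series_drop_1 (fun m => a (S m))) in Ha.
  now replace (l - a 0%nat - a 1%nat) with (l - a 1%nat) in Ha
    by (rewrite H0; ring).
Qed.

Lemma is_series_add_2 (a : nat -> C) (l : C) :
  a 0%nat = 0 -> a 1%nat = 0 ->
  is_series (fun m => a (m + 2)%nat) l -> is_series a l.
Proof.
  intros H0 H1 Ha. apply (is_series_decr_n a 2); [lia |].
  apply (is_series_ext (fun m => a (m + 2)%nat)).
  { intros m. now rewrite Nat.add_comm. }
  match goal with |- is_series _ ?x => replace x with l; [exact Ha |] end.
  simpl pred. rewrite sum_Sn, sum_O, H0, H1.
  change (l = l + - (RtoC 0 + RtoC 0)). ring.
Qed.

Lemma is_series_zeta s :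
  (1 < Re s)%R -> is_series (dirichlet_term s) (zeta s).
Proof.
  intros Hs.
  destruct (ex_series_le (V := C_CompleteNormedModule) (dirichlet_term s) _
              (fun n => Rle_refl _) (ex_series_Cmod_dirichlet_term s Hs))
    as [l Hl].
  replace (zeta s) with l; [exact Hl |].
  symmetry. apply is_series_CSeries.
  apply (is_series_ext (fun m => dirichlet_term s (S m))).
  { intros n. rewrite Nat.add_1_r. unfold dirichlet_term, Cdiv.
    symmetry. apply Cmult_1_l. }
  apply is_series_drop_1 in Hl.
  assert (E : forall z : C, z - dirichlet_term s 0 = z)
    by (intros z; simpl; ring).
  now rewrite E in Hl.
Qed.

(** Spreading a series over the multiples of i does not change its sum: the
    partial sum up to N of the spread series is the partial sum up to N / i of
    the original one. *)
Lemma is_series_multiples {K : AbsRing} {V : NormedModule K}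
    (b : nat -> V) (l : V) (i : nat) :
  (0 < i)%nat -> is_series b l ->
  is_series (fun n => if (n mod i =? 0)%nat then b (n / i)%nat else zero) l.
Proof.
  intros Hi Hb.
  assert (E : forall N, sum_n b (N / i) =
    sum_n (fun n => if (n mod i =? 0)%nat then b (n / i)%nat else zero) N).
  { induction N as [|N IH].
    - rewrite Nat.Div0.div_0_l, !sum_O, Nat.Div0.mod_0_l, Nat.Div0.div_0_l.
      reflexivity.
    - rewrite sum_Sn, <- IH.
      pose proof (Nat.div_mod_eq N i) as HN.
      pose proof (Nat.mod_upper_bound N i ltac:(lia)) as HlN.
      destruct (Nat.eq_dec (S (N mod i)) i) as [e|ne].
      + assert (Hd : (S N / i = S (N / i))%nat)
          by (symmetry; apply (Nat.div_unique _ _ _ 0); nia).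
        assert (Hm : (S N mod i = 0)%nat)
          by (symmetry; apply (Nat.mod_unique _ _ (S (N / i))); nia).
        rewrite Hd, Hm, sum_Sn. reflexivity.
      + assert (Hd : (S N / i = N / i)%nat)
          by (symmetry; apply (Nat.div_unique _ _ _ (S (N mod i))); nia).
        assert (Hm : (S N mod i = S (N mod i))%nat)
          by (symmetry; apply (Nat.mod_unique _ _ (N / i)); nia).
        rewrite Hd, Hm. symmetry. apply plus_zero_r. }
  eapply filterlim_ext; [exact E |].
  eapply filterlim_comp; [| exact Hb].
  intros P [M HM]. exists (M * i)%nat. intros n Hn. apply HM.
  apply Nat.div_le_lower_bound; lia.
Qed.

(** By multiplicativity, the part of zeta supported on the multiples of i is
    i ^ (- s) zeta s. For i = 2 this gives the eta function, and for all i >= 2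
    it evaluates the inner sums after the exchange of summations. *)
Lemma is_series_multiples_dirichlet s i : (1 < Re s)%R -> (0 < i)%nat ->
  is_series (fun n => divides_ind i n * dirichlet_term s n)
    (dirichlet_term s i * zeta s).
Proof.
  intros Hs Hi.
  eapply is_series_ext;
    [| exact (is_series_multiples _ _ i Hi
                (is_series_scal (dirichlet_term s i) _ _
                   (is_series_zeta s Hs)))].
  intros n. cbv beta. unfold divides_ind.
  destruct (Nat.eqb_spec (n mod i) 0) as [e|ne].
  - rewrite Cmult_1_l.
    replace n with (i * (n / i))%nat at 2
      by (apply Nat.Div0.div_exact in e; lia).
    symmetry. apply dirichlet_term_mult.
  - symmetry. apply Cmult_0_l.
Qed.

(** * The eta function *)

Lemma Cpow_m1_parity n : RtoC (- 1) ^ n = 2 * divides_ind 2 n - 1.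
Proof.
  unfold divides_ind.
  destruct (Nat.Even_or_Odd n) as [[k ->]|[k ->]].
  - rewrite Nat.mul_comm, Nat.Div0.mod_mul, Nat.mul_comm, Cpow_mult_r.
    replace (RtoC (-1) ^ 2) with (RtoC 1) by (simpl; ring).
    rewrite Cpow_1_l. simpl. ring.
  - replace ((2 * k + 1) mod 2)%nat with 1%nat
      by (rewrite Nat.add_comm, Nat.mul_comm, Nat.Div0.mod_add; reflexivity).
    rewrite Cpow_add_r, Cpow_mult_r.
    replace (RtoC (-1) ^ 2) with (RtoC 1) by (simpl; ring).
    rewrite Cpow_1_l. simpl. ring.
Qed.

(** Since (- 1) ^ n = 2 [2 divides n] - 1, the alternating series is twice the
    even part of zeta minus zeta. Its sum is also - eta s, and the comparison
    gives the relation between eta and zeta. *)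
Lemma is_series_alternating_dirichlet s : (1 < Re s)%R ->
  is_series (fun n => RtoC (- 1) ^ n * dirichlet_term s n)
    ((2 * dirichlet_term s 2 - 1) * zeta s).
Proof.
  intros Hs.
  pose proof (is_series_scal (RtoC 2) _ _
                (is_series_multiples_dirichlet s 2 Hs ltac:(lia))) as H2.
  replace ((2 * dirichlet_term s 2 - 1) * zeta s)
    with (2 * (dirichlet_term s 2 * zeta s) - zeta s) by ring.
  eapply is_series_ext; 
    [| exact (is_series_minus _ _ _ _ H2 (is_series_zeta s Hs))].
  intros n. rewrite Cpow_m1_parity.
  change (2 * (divides_ind 2 n * dirichlet_term s n) - dirichlet_term s n =
          (2 * divides_ind 2 n - 1) * dirichlet_term s n).
  ring.
Qed.

Lemma eta_zeta s :
  (1 < Re s)%R -> eta s = (1 - 2 * dirichlet_term s 2) * zeta s.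
Proof.
  intros Hs. apply is_series_CSeries.
  pose proof (is_series_drop_1 _ _ (is_series_alternating_dirichlet s Hs)) as H.
  apply (is_series_scal (RtoC (-1))) in H.
  replace ((1 - 2 * dirichlet_term s 2) * zeta s)
    with (RtoC (-1) * ((2 * dirichlet_term s 2 - 1) * zeta s
                       - RtoC (- 1) ^ 0 * dirichlet_term s 0))
    by (simpl (dirichlet_term s 0); ring).
  eapply is_series_ext; [| exact H].
  intros m. rewrite Nat.add_1_r.
  change (RtoC (-1) * (RtoC (- 1) ^ S m * / nat_Cpower (S m) s) =
          RtoC (- 1) ^ m * / nat_Cpower (S m) s).
  rewrite Cpow_S. ring.
Qed.

Lemma is_series_alternating_from_2 s : (1 < Re s)%R ->
  is_series (fun m => RtoC (- 1) ^ (m + 2) * dirichlet_term s (m + 2))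
    (1 - eta s).
Proof.
  intros Hs.
  pose proof (is_series_drop_2 _ _ (Cmult_0_r _)
                (is_series_alternating_dirichlet s Hs)) as H.
  replace (1 - eta s)
    with ((2 * dirichlet_term s 2 - 1) * zeta s
          - RtoC (-1) ^ 1 * dirichlet_term s 1); [exact H |].
  rewrite (eta_zeta s Hs).
  assert (E : dirichlet_term s 1 = 1).
  { change (/ nat_Cpower 1 s = 1). unfold nat_Cpower.
    rewrite INR_1, ln_1, Cmult_0_r, Cexp_0. field. }
  rewrite E, Cpow_1_r. ring.
Qed.

(** * Damped divisor sums *)

(** Coefficients of the divisor sums: (- r) ^ i on i >= 2, extended by 0 so that
    they can be paired with series indexed from 0. *)
Definition alternating_tail (r : R) (i : nat) : C :=
  match i with O | 1%nat => 0 | _ => RtoC (- r) ^ i end.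

Lemma Cmod_alternating_tail r i :
  (0 <= r)%R -> (Cmod (alternating_tail r i) <= r ^ i)%R.
Proof.
  intros Hr.
  destruct i as [|[|i]]; unfold alternating_tail.
  1, 2: rewrite Cmod_0; now apply pow_le.
  rewrite Cmod_pow, Cmod_R, Rabs_Ropp, Rabs_pos_eq by easy. apply Rle_refl.
Qed.

Lemma Cmod_alternating_tail_mult r i z : (0 <= r <= 1)%R ->
  (Cmod (alternating_tail r i * z) <= Cmod z)%R.
Proof.
  intros Hr. rewrite Cmod_mult. rewrite <- (Rmult_1_l (Cmod z)) at 2.
  apply Rmult_le_compat_r; [apply Cmod_ge_0 |].
  eapply Rle_trans; [apply Cmod_alternating_tail; lra |].
  rewrite <- (pow1 i). now apply pow_incr.
Qed.

(** By the evaluation of [F] at integers, [S_damped r] at n is twice the sum of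
    (- r) ^ i over the divisors i >= 2 of n. *)
Lemma S_damped_natC r n l :
  is_series (fun i => alternating_tail r i * divides_ind i n) l ->
  S_damped r (natC n) = 2 * l.
Proof.
  intros Hl. unfold S_damped. f_equal. apply is_series_CSeries.
  apply is_series_drop_2 in Hl; [| apply Cmult_0_l].
  replace l with (l - alternating_tail r 1 * divides_ind 1 n) by (simpl; ring).
  eapply is_series_ext; [| exact Hl].
  intros j. cbv beta zeta. rewrite F_natC by lia. rewrite Nat.add_comm.
  change (RtoC (- r) ^ (2 + j) * divides_ind (2 + j) n =
          RtoC (- r) ^ (2 + j) *
            (divides_ind (2 + j) n * natC (2 + j) ^ 2 / natC (2 + j) ^ 2)).
  assert (Hj : natC (2 + j) <> 0).
  { unfold natC. intros H. apply RtoC_inj in H. revert H. apply not_0_INR. lia. }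
  field. exact Hj.
Qed.

Lemma is_series_S_damped r n : (0 < r < 1)%R ->
  is_series (fun i => alternating_tail r i * divides_ind i n)
    (S_damped r (natC n) / 2).
Proof.
  intros Hr.
  destruct (ex_series_le (V := C_CompleteNormedModule)
    (fun i => alternating_tail r i * divides_ind i n) (fun i => r ^ i)%R)
    as [l Hl].
  - intros i. change (Cmod (alternating_tail r i * divides_ind i n) <= r ^ i)%R.
    rewrite Cmod_mult.
    pose proof (Cmod_alternating_tail r i ltac:(lra)).
    pose proof (Cmod_divides_ind i n).
    pose proof (Cmod_ge_0 (alternating_tail r i)).
    pose proof (Cmod_ge_0 (divides_ind i n)). nra.
  - apply ex_series_geom. rewrite Rabs_pos_eq; lra.
  - rewrite (S_damped_natC r n l Hl).
    assert (E : forall z : C, 2 * z / 2 = z) by (intros z; field).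
    now rewrite E.
Qed.

(** No i >= 2 divides 1: the full Dirichlet series and the one started at n = 2
    agree. *)
Lemma S_damped_1 r : S_damped r (natC 1) = 0.
Proof.
  rewrite (S_damped_natC r 1 (RtoC 0)); [ring |].
  refine (is_series_ext (fun _ => zero : C_NormedModule) _ _ _ is_series_zero).
  intros [|[|i]]; symmetry; [apply Cmult_0_l | apply Cmult_0_l |].
  unfold divides_ind. rewrite Nat.mod_small by lia. apply Cmult_0_r.
Qed.

(** The Dirichlet series of a divisor sum is a product: exchanging the sums over
    i and n leaves, for each i, the part of zeta on the multiples of i. The
    damping supplies the dominating product 2 r ^ i n ^ (- Re s). *)
Lemma is_series_S_damped_dirichlet r s L : (0 < r < 1)%R -> (1 < Re s)%R ->
  is_series (fun i => alternating_tail r i * dirichlet_term s i) L ->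
  is_series (fun n => S_damped r (natC n) * dirichlet_term s n)
    (2 * zeta s * L).
Proof.
  intros Hr Hs HL.
  set (a := alternating_tail r). set (z := dirichlet_term s).
  apply (is_series_exchange
    (fun i n => 2 * (a i * (divides_ind i n * z n)))
    (fun i => 2 * r ^ i)%R (fun n => Cmod (z n))
    _ (fun i => 2 * (a i * (z i * zeta s)))).
  - apply (ex_series_scal_l (V := R_NormedModule)), ex_series_geom.
    rewrite Rabs_pos_eq; lra.
  - now apply ex_series_Cmod_dirichlet_term.
  - intros i n.
    change (Cmod (2 * (a i * (divides_ind i n * z n)))
            <= 2 * r ^ i * Cmod (z n))%R.
    rewrite !Cmod_mult, Cmod_R, Rabs_pos_eq, Rmult_assoc by lra.
    apply Rmult_le_compat_l; [lra |].
    apply Rmult_le_compat;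
      [apply Cmod_ge_0 | apply Rmult_le_pos; apply Cmod_ge_0 | |].
    + apply Cmod_alternating_tail; lra.
    + rewrite <- (Rmult_1_l (Cmod (z n))) at 2.
      apply Rmult_le_compat_r; [apply Cmod_ge_0 | apply Cmod_divides_ind].
  - intros n.
    replace (S_damped r (natC n) * z n)
      with (2 * z n * (S_damped r (natC n) / 2)) by field.
    eapply is_series_ext;
      [| exact (is_series_scal (2 * z n) _ _ (is_series_S_damped r n Hr))].
    intros i. change (2 * z n * (a i * divides_ind i n) =
                      2 * (a i * (divides_ind i n * z n))). ring.
  - intros i. destruct (Nat.eq_dec i 0) as [-> | Hi].
    + replace (2 * (a 0%nat * (z 0%nat * zeta s))) with (RtoC 0)
        by (simpl; ring).
      refine (is_series_ext (fun _ => zero : C_NormedModule) _ _ _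
                is_series_zero).
      intros n. change (RtoC 0 = 2 * (0 * (divides_ind 0 n * z n))). ring.
    + replace (2 * (a i * (z i * zeta s))) with (2 * a i * (z i * zeta s))
        by ring.
      eapply is_series_ext;
        [| exact (is_series_scal (2 * a i) _ _
                    (is_series_multiples_dirichlet s i Hs ltac:(lia)))].
      intros n. change (2 * a i * (divides_ind i n * z n) =
                        2 * (a i * (divides_ind i n * z n))). ring.
  - eapply is_series_ext; [| exact (is_series_scal (2 * zeta s) _ _ HL)].
    intros i. change (2 * zeta s * (a i * z i) = 2 * (a i * (z i * zeta s))).
    ring.
Qed.

(** * Abel limits *)

Lemma ex_series_alternating r s : (0 <= r <= 1)%R -> (1 < Re s)%R ->
  ex_series (fun i => alternating_tail r i * dirichlet_term s i).
Proof.
  intros Hr Hs.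
  apply (ex_series_le (V := C_CompleteNormedModule) _
           (fun i => Cmod (dirichlet_term s i)));
    [| now apply ex_series_Cmod_dirichlet_term].
  intros i. now apply Cmod_alternating_tail_mult.
Qed.

Lemma is_series_alternating_tail s : (1 < Re s)%R ->
  is_series (fun i => alternating_tail 1 i * dirichlet_term s i) (1 - eta s).
Proof.
  intros Hs. apply is_series_add_2; [apply Cmult_0_l | apply Cmult_0_l |].
  eapply is_series_ext; [| exact (is_series_alternating_from_2 s Hs)].
  intros m. cbv beta zeta. rewrite Nat.add_comm. reflexivity.
Qed.

Lemma filterlim_alternating_tail i z :
  filterlim (fun r => alternating_tail r i * z) (at_left 1)
    (locally (alternating_tail 1 i * z)).
Proof.
  destruct i as [|[|i]]; unfold alternating_tail;
    [apply filterlim_const | apply filterlim_const |].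
  apply (filterlim_ext
           (fun r => scal ((- r) ^ S (S i))%R (z : C_R_NormedModule))).
  { intros r. now rewrite scal_R_Cmult, RtoC_pow. }
  rewrite <- RtoC_pow, <- scal_R_Cmult.
  refine (filterlim_comp _ _ _ (fun r : R => (- r) ^ S (S i))%R
            (fun k : R => scal k (z : C_R_NormedModule)) _ _ _
            _ (filterlim_scal_l (V := C_R_NormedModule) _ _)).
  intros P HP. apply filter_le_within.
  refine (ex_derive_continuous (fun r : R => (- r) ^ S (S i))%R 1%R _ P HP).
  auto_derive. exact I.
Qed.

(** The undamped series converges absolutely for Re s > 1, so it dominates the
    damped ones for all r in (0, 1) at once. *)
Lemma filterlim_alternating_series s : (1 < Re s)%R ->
  filterlim
    (fun r => CSeries (fun i => alternating_tail r i * dirichlet_term s i))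
    (at_left 1) (locally (1 - eta s)).
Proof.
  intros Hs.
  apply (tannery (V := C_NormedModule) (at_left 1)
           (fun r i => alternating_tail r i * dirichlet_term s i) _
           (fun i => alternating_tail 1 i * dirichlet_term s i) _
           (fun i => Cmod (dirichlet_term s i))).
  - now apply ex_series_Cmod_dirichlet_term.
  - exists (mkposreal 1 Rlt_0_1). intros r Hr Hr1.
    change (Rabs (r - 1) < 1)%R in Hr. apply Rabs_def2 in Hr.
    split.
    + destruct (ex_series_alternating r s ltac:(lra) Hs) as [l Hl].
      now rewrite (is_series_CSeries _ _ Hl).
    + intros i. apply Cmod_alternating_tail_mult. lra.
  - intros i. apply filterlim_alternating_tail.
  - now apply is_series_alternating_tail.
Qed.

Lemma abel_dirichlet_S_damped s : (1 < Re s)%R ->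
  abel_dirichlet S_damped s (2 * zeta s * (1 - eta s)).
Proof.
  intros Hs.
  exists (fun r => 2 * zeta s *
            CSeries (fun i => alternating_tail r i * dirichlet_term s i)).
  split.
  - intros r Hr.
    destruct (ex_series_alternating r s ltac:(lra) Hs) as [l Hl].
    rewrite (is_series_CSeries _ _ Hl).
    pose proof (is_series_drop_2 _ _ (Cmult_0_r _)
                  (is_series_S_damped_dirichlet r s l Hr Hs Hl)) as H.
    replace (2 * zeta s * l)
      with (2 * zeta s * l - S_damped r (natC 1) * dirichlet_term s 1)
      by (rewrite S_damped_1; ring).
    eapply is_series_ext; [| exact H].
    intros m. cbv beta zeta. rewrite Nat.add_comm. reflexivity.
  - eapply filterlim_comp; [now apply filterlim_alternating_series |].
    exact (filterlim_scal_r (V := C_NormedModule) (2 * zeta s) (1 - eta s)).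
Qed.

Lemma abel_dirichlet_F_damped s : (1 < Re s)%R ->
  abel_dirichlet F_damped s (2 * (zeta s - 1) * (1 - eta s)).
Proof.
  intros Hs. destruct (abel_dirichlet_S_damped s Hs) as [A [HA Hlim]].
  exists (fun r => A r - 2 * (1 - eta s)). split.
  - intros r Hr.
    pose proof (is_series_scal (RtoC 2) _ _
                  (is_series_alternating_from_2 s Hs)) as H2.
    eapply is_series_ext; [| exact (is_series_minus _ _ _ _ (HA r Hr) H2)].
    intros m. cbv zeta beta. unfold F_damped. rewrite Cexp_opp_Ci_PI.
    rewrite (Nat.add_comm m 2).
    change (S_damped r (natC (2 + m)) * / nat_Cpower (2 + m) s
              - 2 * (RtoC (- 1) ^ (2 + m) * / nat_Cpower (2 + m) s) =
            (S_damped r (natC (2 + m)) - 2 * RtoC (- 1) ^ (2 + m))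
              * / nat_Cpower (2 + m) s).
    ring.
  - replace (2 * (zeta s - 1) * (1 - eta s))
      with (2 * zeta s * (1 - eta s) - 2 * (1 - eta s)) by ring.
    apply (filterlim_comp_2 A (fun _ => - (2 * (1 - eta s))) Cplus Hlim
             (filterlim_const _)), (filterlim_plus (V := C_NormedModule)).
Qed.

Theorem proposition6p4 (s : C) (hs : (1 < Re s)%R) :
  abel_dirichlet S_damped s (2 * zeta s * (1 - eta s))%C /\
  abel_dirichlet F_damped s (2 * (zeta s - 1) * (1 - eta s))%C /\
  eta s = ((1 - nat_Cpower 2 (1 - s)) * zeta s)%C.
Proof.
  split; [now apply abel_dirichlet_S_damped |].
  split; [now apply abel_dirichlet_F_damped |].
  rewrite nat_Cpower_1_minus by lia. now apply eta_zeta.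
Qed.
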